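(* The probability function of the $k$-variate inverse $q$-Pólya distribution, with parameters $n$, $(\alpha_1,\alpha_2,\ldots,\alpha_k)$, $\alpha$, and $q$, is given by $$P(W_1=w_1,W_2=w_2,\ldots,W_k=w_k)=\begin{bmatrix}n+u_k-1\\ w_1,w_2,\ldots,w_k\end{bmatrix}_{q^{-m}}q^{-m\sum_{j=1}^{k}(n+u_k-u_j)(\alpha_j-w_j)}\frac{\prod_{j=1}^k[\alpha_j]_{w_j,q^{-m}}\,[\alpha_{k+1}]_{n,q^{-m}}}{[\alpha]_{n+u_k,q^{-m}}},$$ for $w_j=0,1,\ldots$, $j=1,2,\ldots,k$, and $0<q<1$ or $1<q<\infty$, where $\alpha_{k+1}=\alpha-\sum_{j=1}^k\alpha_j$, and $u_j=\sum_{i=1}^j w_i$, for $j=1,2,\ldots,k$.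
   Context: Notation. For real $x$ and a base $p>0$, $p\neq1$ (here $p=q^{-m}$): $[x]_p=(1-p^x)/(1-p)$; $[x]_{s,p}=[x]_p[x-1]_p\cdots[x-s+1]_p$ for $s\ge1$, $[x]_{0,p}=1$; $[s]_p!=[1]_p\cdots[s]_p$, $[0]_p!=1$; and $\begin{bmatrix}x\\ w_1,\ldots,w_k\end{bmatrix}_p=[x]_{w_1+\cdots+w_k,p}/([w_1]_p!\cdots[w_k]_p!)$. Multiple $q$-Pólya urn model. An urn initially contains $r$ balls of $k+1$ ordered colors $c_1,\ldots,c_{k+1}$, with $r_\nu$ balls of color $c_\nu$; $s_0=0$, $s_\nu=\sum_{i=1}^\nu r_i$, $s_{k+1}=r$. Let $m$ be a nonzero integer. Balls are drawn one after the other; after each drawing the drawn ball is placed back in the urn together with $m$ balls of the same color (removal of $-m$ balls of that color if $m<0$). The conditional probability of drawing a ball of color $c_\nu$ at the $i$th drawing, given that $j_\nu-1$ balls of color $c_\nu$ and a total of $i_{\nu-1}$ balls of colors $c_1,\ldots,c_{\nu-1}$ are drawn in the previous $i-1$ drawings ($i_0=0$), is $$\frac{q^{s_{\nu-1}+m i_{\nu-1}}\bigl(1-q^{r_\nu+m(j_\nu-1)}\bigr)}{1-q^{r+m(i-1)}},\qquad \nu=1,\ldots,k+1.$$ Put $\alpha_\nu=-r_\nu/m$ and $\alpha=-r/m$. Let $W_\nu$ be the number of balls of color $c_\nu$ drawn until the $n$th ball of color $c_{k+1}$ is drawn, $\nu=1,\ldots,k$. The distribution of $(W_1,\ldots,W_k)$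 is called the $k$-variate inverse $q$-Pólya distribution with parameters $n$, $(\alpha_1,\ldots,\alpha_k)$, $\alpha$, and $q$. *)

(* Defs.v *)
From mathcomp Require Import all_boot all_order all_algebra.
From mathcomp Require Import all_classical all_reals all_analysis.

Set Implicit Arguments.
Unset Strict Implicit.
Unset Printing Implicit Defensive.

Import Order.TTheory GRing.Theory Num.Theory.
Local Open Scope classical_set_scope.
Local Open Scope ring_scope.

Section QNumbers.
Context {R : realType}.
Implicit Types (p x : R) (s : nat).

Definition qnum p x : R := (1 - p `^ x) / (1 - p).

Definition qfalling p x s : R := \prod_(i < s) qnum p (x - i%:R).

Definition qfactorial p s : R := \prod_(i < s) qnum p i.+1%:R.

Definition qmultinomial p x k (w : 'I_k -> nat) : R :=
  qfalling p x (\sum_i w i)%N / \prod_i qfactorial p (w i).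

End QNumbers.

(* The colors c_1, ..., c_(k+1) are the elements 0, ..., k of 'I_k.+1, and
   [X i omega] is the color of the ball drawn at the (i+1)-st drawing, or [None]
   if no ball is drawn because the urn has been exhausted (possible only for
   m < 0). *)
Section Drawings.
Context {T : Type} {k : nat}.
Variable X : nat -> T -> option 'I_k.+1.

(* The first [size h] drawings have produced the colors listed in [h]. *)
Definition history (h : seq 'I_k.+1) : set T :=
  [set omega | mkseq (X^~ omega) (size h) = map Some h].

Definition ndrawn (c : 'I_k.+1) (t : nat) (omega : T) : nat :=
  (\sum_(i < t) (X i omega == Some c))%N.

(* The number of drawings until the n-th ball of color c is drawn; [None] if
   that never happens. *)
Definition waiting_time (c : 'I_k.+1) (n : nat) (omega : T) : option nat :=
  if pselect (exists t, ndrawn c t omega == n) is left exT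
  then Some (ex_minn exT) else None.

(* W_nu, undefined ([None]) where the n-th ball of color c_(k+1) is never
   drawn. *)
Definition inverse_count (n : nat) (nu : 'I_k) (omega : T) : option nat :=
  omap (fun t => ndrawn (widen_ord (leqnSn k) nu) t omega)
       (waiting_time ord_max n omega).

End Drawings.

Section Urn.
Context {R : realType} {k : nat}.
Variables (q : R) (m : int) (r : 'I_k.+1 -> nat).

Definition total_balls : nat := (\sum_c r c)%N.

(* r + m (i - 1) for the i-th drawing, where t = i - 1 drawings have preceded. *)
Definition urn_size (t : nat) : int := total_balls%:Z + m * t%:Z.

Definition draw_prob (h : seq 'I_k.+1) (c : 'I_k.+1) : R :=
  let s := (\sum_(b < k.+1 | b < c) r b)%N in
  let i := count (fun b : 'I_k.+1 => (b < c)%N) h in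
  q ^ (s%:Z + m * i%:Z) * (1 - q ^ ((r c)%:Z + m * (count_mem c h)%:Z))
  / (1 - q ^ urn_size (size h)).

Definition cond_prob d (T : measurableType d) (P : probability T R)
  (A B : set T) : R := fine (P (A `&` B)) / fine (P B).

Record qpolya_urn d (T : measurableType d) (P : probability T R)
    (X : nat -> T -> option 'I_k.+1) : Prop := QPolyaUrn {
  draw_measurable : forall i o, measurable (X i @^-1` [set o]);
  draw_law : forall h c, urn_size (size h) != 0 -> (0 < P (history X h))%E ->
    cond_prob P (X (size h) @^-1` [set Some c]) (history X h) = draw_prob h c;
  (* When the urn is exhausted, the drawings stop. *)
  draw_stop : forall i j, urn_size i = 0 -> (i <= j)%N ->
    P (X j @^-1` [set~ None]) = 0%E }.

Definition polya_alpha (c : 'I_k) : R :=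
  - (r (widen_ord (leqnSn k) c))%:R / m%:~R.

Definition polya_alpha_total : R := - total_balls%:R / m%:~R.

End Urn.

Definition partial_sum k (w : 'I_k -> nat) (j : 'I_k) : nat :=
  (\sum_(i < k | i <= j) w i)%N.

(* Main.v *)
(** By the multiplication rule the probability of a drawing history is the
    product of its conditional probabilities.  This product depends only on the
    color counts, up to the factor [Q ^ inv] with [Q = q ^ m] and [inv] the
    number of pairs of draws made in increasing color order.  Summing over the
    histories with prescribed counts therefore yields a Q-multinomial
    coefficient; the induction on the last draw rests on the telescoping sum
    [\sum_c Q ^ (v_1 + ... + v_(c-1)) * (1 - Q ^ v_c) = 1 - Q ^ (\sum_c v_c)].
    The event in question is, up to a null set, that the first [n + u_k - 1]
    draws have counts [(w, n - 1)] and the next one has the last color.  The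
    formula is finally rewritten in base [p = Q^-1].  If the urn is exhausted
    before [n + u_k] draws, both sides vanish, the right-hand side because
    division by zero is zero. *)

Require Import Defs.
From mathcomp Require Import all_boot all_order all_algebra.
From mathcomp Require Import all_classical all_reals all_analysis.
From mathcomp Require Import ring.

Set Implicit Arguments.
Unset Strict Implicit.
Unset Printing Implicit Defensive.

Import Order.TTheory GRing.Theory Num.Theory.
Local Open Scope classical_set_scope.
Local Open Scope ring_scope.

(** * Integer powers, tuples of draws and color counts *)

Lemma Posz_sum (I : Type) (s : seq I) (Q : pred I) (f : I -> nat) :
  (\sum_(i <- s | Q i) f i)%N%:Z = \sum_(i <- s | Q i) (f i)%:Z.
Proof. exact: (big_morph Posz PoszD). Qed.

Lemma big_ord_lt_widen (V : Type) (idx : V) (op : Monoid.law idx) n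
    (a : 'I_n.+1 -> V) (i : 'I_n) :
  \big[op/idx]_(b < n.+1 | (b < i)%N) a b =
  \big[op/idx]_(b < n | (b < i)%N) a (widen_ord (leqnSn n) b).
Proof.
rewrite big_mkcond big_ord_recr /= ltnNge ltnW //= Monoid.mulm1.
by rewrite [RHS]big_mkcond.
Qed.

Lemma big_ord_lt_max (V : Type) (idx : V) (op : Monoid.law idx) n
    (a : 'I_n.+1 -> V) :
  \big[op/idx]_(b < n.+1 | (b < @ord_max n)%N) a b =
  \big[op/idx]_(b < n) a (widen_ord (leqnSn n) b).
Proof.
rewrite big_mkcond big_ord_recr /= ltnn Monoid.mulm1.
by apply: eq_bigr => b _; rewrite ltn_ord.
Qed.

(** Each term is the difference of two consecutive powers [q ^ S], with [S] the partial sums of [a].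
    It serves both to normalize the draw probabilities and to sum over the color of the last
    draw. *)
Lemma telescope_exprz (F : fieldType) (q : F) n (a : 'I_n -> int) : q != 0 ->
  \sum_(c < n) q ^ (\sum_(b < n | (b < c)%N) a b) * (1 - q ^ a c) =
  1 - q ^ (\sum_c a c).
Proof.
move=> q0; elim: n a => [|n IHn] a; first by rewrite !big_ord0 expr0z subrr.
rewrite !big_ord_recr big_ord_lt_max /= expfzDr //.
under eq_bigr do rewrite big_ord_lt_widen.
by rewrite (IHn (fun c => a (widen_ord _ c))); ring.
Qed.

Lemma expfz_eq1 (F : realFieldType) (q : F) (z : int) :
  0 < q -> q != 1 -> (q ^ z == 1) = (z == 0).
Proof.
move=> q0 q1; have key n : (q ^+ n.+1 == 1) = false.
  by rewrite pexpr_eq1 ?ltW // (negbTE q1).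
case: z => [[|n]|n]; rewrite ?expr0z ?eqxx //.
  exact: key.
by rewrite [q ^ _]/(q ^- n.+1) invr_eq1 key.
Qed.

(** Conditioning on the last draw: a nonempty tuple corresponds bijectively to its last entry and
    the remaining prefix. *)
Lemma sum_tuple_rcons (V : nmodType) (I : finType) n (Q : pred (seq I))
    (F : seq I -> V) :
  \sum_(h : n.+1.-tuple I | Q h) F h =
  \sum_(c : I) \sum_(h : n.-tuple I | Q (rcons h c)) F (rcons h c).
Proof.
rewrite pair_big_dep /=.
pose f (x : I * n.-tuple I) : n.+1.-tuple I := [tuple of rcons x.2 x.1].
pose g (t : n.+1.-tuple I) : I * n.-tuple I :=
  (last (thead t) (behead t), [tuple of belast (thead t) (behead t)]).
have fK : cancel f g.
  move=> [c h]; rewrite /f /g /thead (tnth_nth c) /=; congr (_, _).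
    by case: (tval h) => [|y s] //=; rewrite last_rcons.
  apply: val_inj => /=.
  by case: (tval h) => [|y s] //=; rewrite belast_rcons.
have gK : cancel g f.
  move=> t; apply: val_inj => /=; case/tupleP: t => y t /=.
  by rewrite theadE -lastI.
rewrite (reindex f) //; first by exists g => x _.
Qed.

Lemma sum_count_mem (I : finType) (h : seq I) :
  (\sum_c count_mem c h)%N = size h.
Proof.
elim: h => [|x h IHh] /=; first by rewrite big1.
by rewrite big_split IHh (bigD1 x) //= eqxx big1 // => i /negbTE; rewrite eq_sym => ->.
Qed.

Lemma count_ltn_ord n (c : 'I_n) (h : seq 'I_n) :
  count (fun b : 'I_n => (b < c)%N) h = (\sum_(b < n | (b < c)%N) count_mem b h)%N.
Proof.
elim: h => [|x h IHh] /=; first by rewrite big1.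
rewrite big_split -IHh /=; congr (_ + _)%N.
have [xc|xc] := boolP (x < c)%N.
  by rewrite (bigD1 x) //= eqxx big1 // => b /andP[_ /negbTE]; rewrite eq_sym => ->.
by rewrite big1 // => b bc; apply/eqP; rewrite eqb0; apply: contraNneq xc => ->.
Qed.

(** The counts before a last draw of color [c]. Subtraction is truncated, so this reading requires
    [0 < v c]. *)
Definition decr_count (I : eqType) (v : I -> nat) (c b : I) : nat :=
  (v b - (b == c))%N.

Lemma decr_count_id (I : eqType) (v : I -> nat) (c : I) :
  decr_count v c c = (v c).-1.
Proof. by rewrite /decr_count eqxx subn1. Qed.

Lemma prod_decr_count (F : comPzRingType) (I : finType) (v : I -> nat) (c : I)
    (g : I -> nat -> F) : (0 < v c)%N ->
  \prod_b \prod_(i < v b) g b i =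
  (\prod_b \prod_(i < decr_count v c b) g b i) * g c (v c).-1.
Proof.
move=> vc; rewrite (bigD1 c) //= [X in _ = X * _](bigD1 c) //=.
rewrite decr_count_id -[in LHS](prednK vc) big_ord_recr /=.
rewrite mulrAC; congr (_ * _ * _); apply: eq_bigr => b /negbTE bc.
by rewrite /decr_count bc subn0.
Qed.

Lemma sum_decr_count (I : finType) (v : I -> nat) (c : I) : (0 < v c)%N ->
  (\sum_b v b = (\sum_b decr_count v c b).+1)%N.
Proof.
move=> vc; rewrite (bigD1 c) //= [X in _ = X.+1](bigD1 c) //=.
rewrite decr_count_id -addSn (prednK vc); congr (_ + _)%N.
by apply: eq_bigr => b /negbTE bc; rewrite /decr_count bc subn0.
Qed.

(** * The law of the color counts *)

Section CountLaw.
Context {R : realType} {k : nat}.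
Variables (q : R) (m : int) (r : 'I_k.+1 -> nat).
Hypotheses (q_gt0 : 0 < q) (q_neq1 : q != 1) (m_neq0 : m != 0).
Implicit Types (v : 'I_k.+1 -> nat) (h : seq 'I_k.+1).

Let q_neq0 : q != 0. Proof. exact: lt0r_neq0. Qed.

Lemma onem_exprz_neq0 (z : int) : z != 0 -> 1 - q ^ z != 0.
Proof. by move=> z0; rewrite subr_eq0 eq_sym expfz_eq1. Qed.

Definition urn_offset (c : 'I_k.+1) : nat := (\sum_(b < k.+1 | (b < c)%N) r b)%N.

(** The numerators telescope, with [a c] the current content of color [c]; these contents add up to
    the urn size. *)
Lemma sum_draw_prob h : urn_size m r (size h) != 0 ->
  \sum_c draw_prob q m r h c = 1.
Proof.
move=> /onem_exprz_neq0 D.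
pose a c : int := (r c)%:Z + m * (count_mem c h)%:Z.
have aE : \sum_c a c = urn_size m r (size h).
  rewrite /a big_split /= -mulr_sumr /urn_size /total_balls -(sum_count_mem h).
  by rewrite !Posz_sum.
rewrite -[RHS](divff D) -[in X in _ = X / _]aE -telescope_exprz // mulr_suml.
apply: eq_bigr => c _; rewrite /draw_prob count_ltn_ord; congr (q ^ _ * _ / _).
by rewrite big_split /= -mulr_sumr !Posz_sum.
Qed.

(** The middle factor is the multinomial coefficient in base [q ^ m]. The outer factors are what all
    histories with counts [v] share: a draw of color [c] contributes [q ^ urn_offset c], a
    replenished color content and an urn size. *)
Definition count_law v : R :=
  q ^ (\sum_c (v c * urn_offset c))%N%:Z
  * (\prod_(i < (\sum_c v c)%N) (1 - q ^ (m * i.+1%:Z))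
     / \prod_c \prod_(i < v c) (1 - q ^ (m * i.+1%:Z)))
  * (\prod_c \prod_(i < v c) (1 - q ^ ((r c)%:Z + m * i%:Z))
     / \prod_(i < (\sum_c v c)%N) (1 - q ^ urn_size m r i)).

(** The last draw supplies the missing color, offset and urn factors; what remains is the ratio of
    the two multinomial coefficients. *)
Lemma count_law_decr v c : (0 < v c)%N ->
  count_law (decr_count v c) *
    (q ^ (urn_offset c)%:Z * (1 - q ^ ((r c)%:Z + m * (v c).-1%:Z))
     / (1 - q ^ urn_size m r (\sum_b v b)%N.-1)) =
  count_law v * ((1 - q ^ (m * (v c)%:Z)) / (1 - q ^ (m * (\sum_b v b)%N%:Z))).
Proof.
move=> vc; rewrite {2}/count_law.
rewrite (prod_decr_count (fun _ i => 1 - q ^ (m * i.+1%:Z)) vc).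
rewrite (prod_decr_count (fun c i => 1 - q ^ ((r c)%:Z + m * i%:Z)) vc).
have -> : (\sum_b v b * urn_offset b =
   \sum_b decr_count v c b * urn_offset b + urn_offset c)%N.
  rewrite (bigD1 c) //= [X in (_ = X + _)%N](bigD1 c) //=.
  rewrite decr_count_id addnAC -mulSnr (prednK vc); congr (_ + _)%N.
  by apply: eq_bigr => b /negbTE bc; rewrite /decr_count bc subn0.
have mS n : 1 - q ^ (m * n.+1%:Z) != 0 by rewrite onem_exprz_neq0 // mulf_neq0.
have recr (g : nat -> R) : \prod_(i < (\sum_b v b)%N) g i =
    (\prod_(i < (\sum_b decr_count v c b)%N) g i) * g (\sum_b v b)%N.-1.
  by rewrite (sum_decr_count vc) big_ord_recr.
rewrite (recr (fun i => 1 - q ^ (m * i.+1%:Z))).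
rewrite (recr (fun i => 1 - q ^ urn_size m r i)) (prednK vc).
have vpos : (0 < \sum_b v b)%N by rewrite (sum_decr_count vc).
rewrite (prednK vpos).
have := mS (v c).-1; rewrite (prednK vc) => x1.
have := mS (\sum_b v b)%N.-1; rewrite (prednK vpos) => x2.
(* Only [y1] and [y2] have to cancel. The urn factor [y4] merely moves between denominators, which
   is valid even for the inverse of zero. *)
have key (e1 e2 p1 p2 p3 p4 y1 y2 y3 y4 : R) : y1 != 0 -> y2 != 0 ->
    e1 * (p1 / p2) * (p3 / p4) * (e2 * y3 / y4) =
    (e1 * e2) * ((p1 * y2) / (p2 * y1)) * ((p3 * y3) / (p4 * y4)) * (y1 / y2).
  move=> y10 y20; rewrite !invfM.
  rewrite -[LHS]mulr1 -(divff y10) -[LHS]mulr1 -[X in _ * X](divff y20); ring.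
rewrite PoszD (expfzDr (\sum_b decr_count v c b * urn_offset b)%N%:Z) //.
exact: key.
Qed.

(** [draw_prob] sees a history only through its color counts, so the probability of the last draw is
    constant on the sum and factors out. This is used both in the induction over all last colors
    and, with [c = ord_max], for the stopping draw. *)
Lemma sum_histories_rcons N (f : seq 'I_k.+1 -> R) v c :
  (forall h b, (size h <= N)%N -> f (rcons h b) = f h * draw_prob q m r h b) ->
  (0 < v c)%N -> (\sum_b v b)%N = N.+1 ->
  \sum_(h : N.-tuple 'I_k.+1 | [forall b, count_mem b h == decr_count v c b]) f h
    = count_law (decr_count v c) ->
  \sum_(h : N.-tuple 'I_k.+1 | [forall b, count_mem b h == decr_count v c b])
    f (rcons h c) =
  count_law v * ((q ^ (\sum_(b < k.+1 | (b < c)%N) m * (v b)%:Z))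
    * (1 - q ^ (m * (v c)%:Z)) / (1 - q ^ (m * N.+1%:Z))).
Proof.
move=> fS vc vN IHN.
transitivity (\sum_(h : N.-tuple _ | [forall b, count_mem b h == decr_count v c b])
    f h * (q ^ (\sum_(b < k.+1 | (b < c)%N) m * (v b)%:Z)
      * (q ^ (urn_offset c)%:Z * (1 - q ^ ((r c)%:Z + m * (v c).-1%:Z))
   / (1 - q ^ urn_size m r (\sum_b v b)%N.-1)))).
  apply: eq_bigr => h /forallP hv; rewrite fS ?size_tuple //; congr (_ * _).
  rewrite /draw_prob size_tuple vN /= (eqP (hv c)) decr_count_id.
  rewrite !mulrA; congr (_ * _ / _); rewrite expfzDr // mulrC; congr (q ^ _ * _).
  rewrite count_ltn_ord Posz_sum mulr_sumr; apply: eq_bigr => b bc.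
  rewrite (eqP (hv b)) /decr_count; case: (b =P c) bc => [->|_ _]; first by rewrite ltnn.
  by rewrite subn0.
rewrite -mulr_suml IHN.
by rewrite mulrCA count_law_decr // vN; ring.
Qed.

(** Induction on the last draw: each color [c] contributes [count_law v] times a weight, and by
    telescoping the weights sum to 1. *)
Lemma sum_histories_count_law N (f : seq 'I_k.+1 -> R) v :
  f [::] = 1 ->
  (forall h c, (size h < N)%N -> f (rcons h c) = f h * draw_prob q m r h c) ->
  (\sum_c v c)%N = N ->
  \sum_(h : N.-tuple 'I_k.+1 | [forall c, count_mem c h == v c]) f h =
  count_law v.
Proof.
move=> f0; elim: N v => [|N IHN] v fS vN.
  have v0 c : v c = 0%N by apply/eqP; move/eqP: vN; rewrite sum_nat_eq0 => /forallP/(_ c).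
  have -> : count_law v = 1.
    rewrite /count_law vN !big_ord0 big1 => [|c _]; last by rewrite v0 mul0n.
    rewrite big1 => [|c _]; last by rewrite v0 big_ord0.
    by rewrite big1 => [|c _]; rewrite ?v0 ?big_ord0 // expr0z !invr1 !mulr1.
  rewrite (big_pred1 [tuple]) // => h; rewrite tuple0 /= eqxx.
  by apply/forallP => c; rewrite v0.
rewrite (sum_tuple_rcons _ (fun h => [forall c, count_mem c h == v c])).
have step c : \sum_(h : N.-tuple _ | [forall b, count_mem b (rcons h c) == v b])
    f (rcons h c) =
  count_law v * ((q ^ (\sum_(b < k.+1 | (b < c)%N) m * (v b)%:Z))
    * (1 - q ^ (m * (v c)%:Z)) / (1 - q ^ (m * N.+1%:Z))).
  (* If [v c = 0], no history ending in [c] has these counts, and the weight vanishes because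
     [1 - q ^ 0 = 0]. *)
  have [vc|] := posnP (v c).
    rewrite vc mulr0 expr0z subrr mulr0 mul0r mulr0 big1 // => h /forallP/(_ c).
    by rewrite vc -cats1 count_cat /= eqxx addn1.
  move=> vc.
  have countE h : [forall b, count_mem b (rcons h c) == v b] =
      [forall b, count_mem b h == decr_count v c b].
    apply: eq_forallb => b; rewrite -cats1 count_cat /= addn0 /decr_count eq_sym.
    rewrite (eq_sym c); case: (b =P c) => [->|_]; last by rewrite addn0 subn0 eq_sym.
    by rewrite addn1 subn1 -(prednK vc) /= eqSS eq_sym.
  under eq_bigl do rewrite countE.
  have vN' : (\sum_b decr_count v c b)%N = N.
    by apply: succn_inj; rewrite -vN -sum_decr_count.
  apply: sum_histories_rcons => //.
  by apply: IHN => // h b hN; rewrite fS // ltnW.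
under eq_bigr do rewrite step.
rewrite -mulr_sumr -mulr_suml telescope_exprz // -mulr_sumr -Posz_sum vN divff ?mulr1 //.
by rewrite onem_exprz_neq0 // mulf_neq0.
Qed.

(** Before exhaustion the histories carry the whole mass, which leaves none for the outcome
    [None]. *)
Lemma sum_histories N (f : seq 'I_k.+1 -> R) :
  f [::] = 1 ->
  (forall h c, (size h < N)%N -> f (rcons h c) = f h * draw_prob q m r h c) ->
  (forall i, (i < N)%N -> urn_size m r i != 0) ->
  \sum_(h : N.-tuple 'I_k.+1) f h = 1.
Proof.
move=> f0; elim: N => [|N IHN] fS urn.
  by rewrite (big_pred1 [tuple]) // => h; apply/esym/eqP; apply: tuple0.
rewrite (sum_tuple_rcons _ predT) exchange_big /= -[RHS]IHN; last 2 first.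
- by move=> h c hN; rewrite fS // ltnW.
- by move=> i iN; rewrite urn // ltnW.
apply: eq_bigr => h _.
under eq_bigr do rewrite fS ?size_tuple //.
by rewrite -mulr_sumr sum_draw_prob ?mulr1 // size_tuple urn.
Qed.

End CountLaw.

(** * Finite unions and events described by drawing histories *)

Lemma measure_finType_bigcup d (T : measurableType d) (R : realFieldType)
    (mu : {measure set T -> \bar R}) (I : finType) (Q : pred I) (F : I -> set T) :
  (forall i, measurable (F i)) -> trivIset setT F ->
  mu (\bigcup_(i in [set i | Q i]) F i) = (\sum_(i | Q i) mu (F i))%E.
Proof.
move=> mF tF; transitivity (\sum_(i \in [set` Q]) mu (F i))%E.
  apply: measure_fin_bigcup => [|i j _ _|i _].
  - exact: finite_finset.
  - exact: tF.
  - exact: mF.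
by rewrite (bigfs _ (index_enum_uniq I)) // => i _; rewrite mem_index_enum.
Qed.

Section History.
Context {T : Type} {k : nat}.
Variable X : nat -> T -> option 'I_k.+1.

Definition prefix_draws (N : nat) (omega : T) := mkseq (X^~ omega) N.

Lemma ndrawnE c N omega :
  ndrawn X c N omega = count_mem (Some c) (prefix_draws N omega).
Proof.
rewrite /ndrawn; elim: N => [|N IHN]; first by rewrite big_ord0.
by rewrite big_ord_recr IHN /prefix_draws mkseqS -cats1 count_cat /= addn0.
Qed.

Lemma ndrawnS c N omega :
  ndrawn X c N.+1 omega = (ndrawn X c N omega + (X N omega == Some c))%N.
Proof. by rewrite /ndrawn big_ord_recr. Qed.

Lemma ndrawn_homo c omega : {homo (ndrawn X c)^~ omega : s t / (s <= t)%N}.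
Proof.
by apply: homo_leq => [//|? ? ?|t]; [exact: leq_trans | rewrite ndrawnS leq_addr].
Qed.

Lemma sum_ndrawn N omega :
  (\sum_c ndrawn X c N omega = \sum_(i < N) (X i omega != None))%N.
Proof.
rewrite exchange_big; apply: eq_bigr => i _ /=.
case: (X i omega) => [c|]; last by rewrite big1.
rewrite (bigD1 c) //= eqxx big1 // => b /negbTE; rewrite eq_sym => bc.
by apply/eqP; rewrite eqb0; apply/eqP => -[] /eqP; rewrite bc.
Qed.

Lemma sum_ndrawn_le N omega : (\sum_c ndrawn X c N omega <= N)%N.
Proof.
rewrite sum_ndrawn -[leqRHS](card_ord N) -sum1_card.
by apply: leq_sum => i _; case: (_ != _).
Qed.

Lemma history_rcons h c :
  history X (rcons h c) = X (size h) @^-1` [set Some c] `&` history X h.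
Proof.
apply/seteqP; split => omega; rewrite /history /= size_rcons mkseqS map_rcons.
  by move=> /rcons_inj[-> ->].
by move=> [-> ->].
Qed.

Lemma history_nil : history X [::] = setT.
Proof. by apply/seteqP; split. Qed.

Lemma history_trivIset N :
  trivIset setT (fun h : N.-tuple 'I_k.+1 => history X h).
Proof.
move=> h1 h2 _ _ [omega []]; rewrite /history /= !size_tuple => -> /inj_map.
by move=> /(_ Some_inj) /val_inj.
Qed.

Lemma bigcup_historyP N omega :
  (\bigcup_(h in [set: N.-tuple 'I_k.+1]) history X h) omega <->
  forall i, (i < N)%N -> X i omega != None.
Proof.
split=> [[h _ hh] i iN|XN].
  move: hh; rewrite /history /= size_tuple => hh.
  have := congr1 (fun s => nth None s i) hh; rewrite nth_mkseq // => ->.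
  by rewrite (nth_map ord0) ?size_tuple.
(* The default [ord0] is never reached, since the first [N] draws all show a color. *)
pose h := mktuple (fun i : 'I_N => odflt ord0 (X i omega)).
exists h => //; rewrite /history /= size_tuple /h /= /mkseq card_ord.
rewrite -val_enum_ord -!map_comp.
apply: eq_map => i /=; have := XN i (ltn_ord i).
by case: (X i omega).
Qed.

Lemma ndrawn_history c h omega : history X h omega ->
  ndrawn X c (size h) omega = count_mem c h.
Proof.
rewrite /history /= ndrawnE /prefix_draws => ->.
by rewrite count_map; apply: eq_count => b /=; apply/eqP/eqP => [[]|->].
Qed.

(** Here [t] counts the draws before the stopping one, so the waiting time is [t.+1] and only [n.-1]
    balls of the last color precede. With [k = 0] the left side would hold vacuously. *)
Lemma inverse_countP n (w : 'I_k -> nat) omega : (0 < k)%N -> (0 < n)%N ->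
  (forall j, inverse_count X n j omega = Some (w j)) <->
  exists t, [/\ X t omega = Some ord_max, ndrawn X ord_max t omega = n.-1 &
    forall j, ndrawn X (widen_ord (leqnSn k) j) t omega = w j].
Proof.
move=> k0 n0.
have neq_max (j : 'I_k) : (Some ord_max == Some (widen_ord (leqnSn k) j)) = false.
  by apply/eqP => -[kj]; have := ltn_ord j; rewrite -kj ltnn.
rewrite /inverse_count /waiting_time; case: pselect => [exT|noT]; last first.
  split=> [/(_ (Ordinal k0))//|[t [Xt nt _]]].
  by case: noT; exists t.+1; rewrite ndrawnS nt Xt eqxx addn1 prednK.
case: ex_minnP => t' nt' min_t'; split=> [H|[t [Xt nt ct]] j].
- case: t' nt' min_t' H => [|t].
    by rewrite /ndrawn big_ord0 => /eqP n0'; rewrite -n0' in n0.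
  move=> nt min_t H.
  (* Otherwise the count would already be [n] after [t] draws, against minimality. *)
  have Xt : X t omega = Some ord_max.
    apply/eqP/negPn/negP => /negbTE Xt; move: nt; rewrite ndrawnS Xt addn0.
    by move=> /min_t; rewrite ltnn.
  exists t; split=> // [|j].
    by move: nt; rewrite ndrawnS Xt eqxx addn1 => /eqP <-.
  by have [<-] := H j; rewrite ndrawnS Xt neq_max addn0.
(* Minimality gives [t' <= t.+1]; since the count is monotone and only [n.-1] at [t], a smaller [t']
   is impossible. *)
- have -> : t' = t.+1.
    apply/eqP; rewrite eqn_leq min_t' /=; last by rewrite ndrawnS nt Xt eqxx addn1 prednK.
    rewrite ltnNge; apply/negP => /(ndrawn_homo ord_max omega).
    by rewrite (eqP nt') nt -ltnS prednK // ltnn.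
  by rewrite /= ndrawnS Xt neq_max addn0 ct.
Qed.

(* The [t] drawings before the last one may include [None]s. *)
Definition stop_event (v : 'I_k.+1 -> nat) : set T :=
  [set omega | exists t, X t omega = Some ord_max /\
    forall c, ndrawn X c t omega = v c].

End History.

(** * Probabilities of histories and of the stopping event *)

Section UrnProbability.
Context {R : realType} {k : nat} (q : R) (m : int) (r : 'I_k.+1 -> nat).
Context d (T : measurableType d) (P : probability T R).
Variable X : nat -> T -> option 'I_k.+1.
Hypothesis hX : qpolya_urn q m r P X.

Let mX i o : measurable (X i @^-1` [set o]). Proof. exact: draw_measurable hX i o. Qed.

Lemma measurable_history h : measurable (history X h).
Proof.
elim/last_ind: h => [|h c IHh]; first by rewrite history_nil.
by rewrite history_rcons; apply: measurableI.
Qed.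

Lemma measurable_ndrawn c N a : measurable [set omega | ndrawn X c N omega = a].
Proof.
elim: N a => [|N IHN] a.
  have [->|a0] := eqVneq a 0%N.
    rewrite [X in measurable X](_ : _ = setT) //.
    by apply/seteqP; split=> omega //= _; rewrite /ndrawn big_ord0.
  rewrite [X in measurable X](_ : _ = set0) //.
  apply/seteqP; split=> omega //=; rewrite /ndrawn big_ord0 => a0'.
  by rewrite -a0' in a0.
rewrite [X in measurable X](_ : _ =
  ([set omega | (ndrawn X c N omega).+1 = a] `&` X N @^-1` [set Some c]) `|`
  ([set omega | ndrawn X c N omega = a] `&` ~` (X N @^-1` [set Some c]))).
  apply: measurableU; apply: measurableI => //; last exact: measurableC.
  case: a => [|a].
    by rewrite [X in measurable X](_ : _ = set0) //; apply/seteqP; split.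
  rewrite [X in measurable X](_ : _ = [set omega | ndrawn X c N omega = a]) //.
  by apply/seteqP; split=> omega /= => [[]|->].
apply/seteqP; split=> omega /=; rewrite ndrawnS.
  by case: eqP => XN; rewrite ?addn1 ?addn0; [left|right].
by move=> [[+ ->]|[+ /eqP/negbTE ->]]; rewrite ?eqxx ?addn1 ?addn0.
Qed.

Definition hist_prob (h : seq 'I_k.+1) : R := fine (P (history X h)).

Lemma hist_prob_nil : hist_prob [::] = 1.
Proof. by rewrite /hist_prob history_nil probability_setT. Qed.

Lemma hist_probE h : P (history X h) = (hist_prob h)%:E.
Proof. by rewrite fineK // fin_num_measure //; apply: measurable_history. Qed.

(** The multiplication rule extends to null histories, about which [draw_law] is silent: a longer
    history is contained in a shorter one, so both sides are 0. *)
Lemma hist_prob_rcons h c : urn_size m r (size h) != 0 ->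
  hist_prob (rcons h c) = hist_prob h * draw_prob q m r h c.
Proof.
move=> urn; have [h0|h0] := eqVneq (hist_prob h) 0.
  rewrite h0 mul0r /hist_prob (_ : P _ = 0%E) //.
  apply: (@subset_measure0 _ _ _ P _ (history X h)); try exact: measurable_history.
  by rewrite history_rcons; apply: subIsetr.
  by have := hist_probE h; rewrite h0.
have Ppos : (0 < P (history X h))%E.
  by rewrite lt0e measure_ge0 andbT; apply: contra_neq h0; rewrite /hist_prob => ->.
rewrite -(draw_law hX c urn Ppos) /cond_prob -history_rcons.
by rewrite -/(hist_prob _) -/(hist_prob _) mulrC divfK.
Qed.

Lemma prob_bigcup_history N (Q : pred (seq 'I_k.+1)) :
  P (\bigcup_(h in [set h : N.-tuple 'I_k.+1 | Q h]) history X h) =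
  (\sum_(h : N.-tuple 'I_k.+1 | Q h) hist_prob h)%:E.
Proof.
rewrite (measure_finType_bigcup P (fun h : N.-tuple 'I_k.+1 => Q h)).
- by rewrite -sumEFin; apply: eq_bigr => h _; exact: hist_probE.
- by move=> h; apply: measurable_history.
- exact: history_trivIset.
Qed.

Lemma measurable_none : forall i, measurable (X i @^-1` [set~ None]).
Proof. by move=> i; apply: measurableC (mX i None). Qed.

(** The urn model does not state this directly; it follows because the histories of length [N] are
    disjoint events of total probability 1. *)
Lemma negligible_draw_none N : 0 < q -> q != 1 ->
  (forall i, (i < N)%N -> urn_size m r i != 0) ->
  P.-negligible [set omega | exists2 i, (i < N)%N & X i omega = None].
Proof.
move=> q0 q1 urn.
pose A := \bigcup_(h in [set h : N.-tuple 'I_k.+1 | predT (tval h)]) history X h.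
have mA : measurable A.
  apply: fin_bigcup_measurable => [|h _]; first exact: finite_finset.
  exact: measurable_history.
exists (~` A); split; first exact: measurableC.
  rewrite [LHS](probability_setC P mA) /A (prob_bigcup_history _ predT).
  rewrite (sum_histories q0 q1 hist_prob_nil _ urn) ?subee // => h c hN.
  by rewrite hist_prob_rcons // urn.
move=> omega /= [i iN Xi] [h _ hh].
have := (bigcup_historyP X N omega).1 (ex_intro2 _ _ h I hh) i iN.
by rewrite Xi.
Qed.

Lemma negligible_draw_exhausted i : urn_size m r i = 0 ->
  P.-negligible (\bigcup_(j in [set j | (i <= j)%N]) (X j @^-1` [set~ None])).
Proof.
move=> ui; rewrite bigcup_mkcond; apply: negligible_bigcup => j.
case: ifPn => [/set_mem /= ij|_]; last exact: negligible_set0.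
apply/negligibleP; first exact: measurable_none.
exact: draw_stop hX _ _ ui ij.
Qed.

Lemma measurable_stop_event v : measurable (stop_event X v).
Proof.
rewrite [X in measurable X](_ : _ = \bigcup_t (X t @^-1` [set Some ord_max] `&`
    \bigcap_(c in [set` predT]) [set omega | ndrawn X c t omega = v c])).
  apply: bigcupT_measurable => t; apply: measurableI => //.
  apply: fin_bigcap_measurable => [|c _]; first exact: finite_finset.
  exact: measurable_ndrawn.
apply/seteqP; split=> omega.
  by move=> [t [Xt nt]]; exists t => //; split=> // c _; apply: nt.
by move=> [t _ [Xt nt]]; exists t; split=> // c; apply: nt.
Qed.

(** Drawing [\sum_c v c] balls takes at least that many drawings, so the stopping draw would show a
    color after exhaustion. *)
Lemma prob_stop_event_exhausted v i : (i <= \sum_c v c)%N ->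
  urn_size m r i = 0 -> P (stop_event X v) = 0%E.
Proof.
move=> iv ui; apply/(negligibleP _ (measurable_stop_event v)).
apply: negligibleS (negligible_draw_exhausted ui) => omega [t [Xt nt]].
exists t => /=; last by rewrite Xt.
apply: leq_trans iv _; under eq_bigr do rewrite -nt.
exact: sum_ndrawn_le.
Qed.

(** Outside the null event of an early [None], the stopping event is the disjoint union [B] of the
    histories with counts [v] followed by the last color. *)
Lemma prob_stop_event v : 0 < q -> q != 1 ->
  (forall i, (i <= \sum_c v c)%N -> urn_size m r i != 0) ->
  P (stop_event X v) = (\sum_(h : (\sum_c v c)%N.-tuple 'I_k.+1 |
    [forall c, count_mem c h == v c]) hist_prob (rcons h ord_max))%:E.
Proof.
set M := (\sum_c v c)%N => q0 q1 urn.
pose Q (h : M.-tuple 'I_k.+1) := [forall c, count_mem c h == v c].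
pose B := \bigcup_(h in [set h | Q h]) history X (rcons h ord_max).
have tB : trivIset setT (fun h : M.-tuple 'I_k.+1 => history X (rcons h ord_max)).
  move=> h1 h2 _ _ [omega []]; rewrite !history_rcons => -[_ H1] [_ H2].
  by apply: (@history_trivIset _ _ X M h1 h2 I I); exists omega.
have mh (h : M.-tuple 'I_k.+1) : measurable (history X (rcons h ord_max)).
  exact: measurable_history.
have mB : measurable B by apply: fin_bigcup_measurable => //; exact: finite_finset.
have BE : B `<=` stop_event X v.
  move=> omega [h /forallP hv]; rewrite history_rcons => -[/= Xh hh].
  by exists (size h); split=> // c; rewrite ndrawn_history // (eqP (hv c)).
(* One draw beyond the first [M] is included in order to exclude [M < t] below. *)
have [N [mN N0 EN]] := negligible_draw_none (N := M.+1) q0 q1 urn.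
have EB : stop_event X v `<=` B `|` N.
  move=> omega [t [Xt nt]].
  have [Xn|/existsNP[i /not_implyP[iM Xi]]] :=
      pselect (forall i, (i < M.+1)%N -> X i omega != None); last first.
    by right; apply: EN; exists i => //; apply/eqP/negPn/negP.
  (* Exactly [M] of the first [t] draws show a color, so [M <= t]; if [M < t], the first [M.+1]
     draws would already give more than [M] colors. *)
  left; have tM : t = M.
    have Mt : M = (\sum_c ndrawn X c t omega)%N by under [RHS]eq_bigr do rewrite nt.
    apply/eqP; rewrite eqn_leq andbC {1}Mt sum_ndrawn_le /=.
    rewrite sum_ndrawn in Mt.
    rewrite leqNgt; apply/negP => Mlt; have : (M < M)%N; last by rewrite ltnn.
    rewrite [X in (_ < X)%N]Mt.
    rewrite -(big_mkord predT (fun i => nat_of_bool (X i omega != None))).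
    rewrite (big_cat_nat (n := M.+1)) //= big_mkord.
    apply: leq_trans (leq_addr _ _); rewrite -[leqLHS](card_ord M.+1) -sum1_card.
    by apply: leq_sum => i _; rewrite Xn.
  subst t; have := (bigcup_historyP X M omega).2.
  case=> [i iM|h _ hh]; first exact/Xn/ltnW.
  exists h; last by rewrite history_rcons; split=> //=; rewrite size_tuple.
  apply/forallP => c; rewrite -(ndrawn_history c hh) size_tuple; exact/eqP/nt.
have -> : P (stop_event X v) = P B.
  apply/eqP; rewrite eq_le; apply/andP; split.
    rewrite -(measureU0 mB mN N0) le_measure // inE; last exact: measurableU.
    exact: measurable_stop_event.
  by apply: le_measure; rewrite ?inE //; exact: measurable_stop_event.
rewrite (measure_finType_bigcup P Q) // -sumEFin.
by apply: eq_bigr => h _; exact: hist_probE.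
Qed.

End UrnProbability.

(** * Sums over ordered pairs and triangular numbers *)

Lemma exchange_sum_ltn k (v r : 'I_k -> nat) :
  (\sum_c v c * (\sum_(b < k | b < c) r b) =
   \sum_b r b * (\sum_(c < k | b < c) v c))%N.
Proof.
under eq_bigr do rewrite big_distrr /=.
rewrite (exchange_big_dep predT) //=; apply: eq_bigr => b _.
by rewrite big_distrr; apply: eq_bigr => c _; rewrite mulnC.
Qed.

(** The triangular number [n (n + 1) / 2], kept as the sum of exponents that a q-factorial produces
    under the change of base. *)
Definition triangle (n : nat) : nat := (\sum_(i < n) i.+1)%N.

Lemma triangleD a b : triangle (a + b) = (triangle a + \sum_(i < b) (a + i).+1)%N.
Proof. by rewrite /triangle big_split_ord. Qed.

(** A triangular number counts pairs [i <= j]; splitting the points into blocks of sizes [w j]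
    separates pairs within a block from pairs across two blocks. *)
Lemma triangle_sum k (w : 'I_k -> nat) :
  triangle (\sum_j w j)%N =
  (\sum_j triangle (w j) + \sum_j w j * (\sum_(i < k | j < i) w i))%N.
Proof.
rewrite -exchange_sum_ltn; elim: k w => [|k IHk] w.
  by rewrite !big_ord0 /triangle big_ord0.
rewrite !big_ord_recr /= big_ord_lt_max triangleD IHk.
have -> : (\sum_(i < k) w (widen_ord (leqnSn k) i) * (\sum_(b < k.+1 | b < i) w b) =
    \sum_(i < k) w (widen_ord (leqnSn k) i) *
      (\sum_(b < k | b < i) w (widen_ord (leqnSn k) b)))%N.
  by apply: eq_bigr => i _; rewrite big_ord_lt_widen.
rewrite -!addnA; congr (_ + _)%N; rewrite addnCA; congr (_ + _)%N.
transitivity (\sum_(i < w ord_max)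
    (\sum_(j < k) w (widen_ord (leqnSn k) j) + i.+1))%N.
  by apply: eq_bigr => i _; rewrite addnS.
by rewrite big_split /= sum_nat_const card_ord addnC.
Qed.

(** * Passage between the bases [q ^ m] and [p = q ^ (- m)] *)

Section BaseChange.
Context {R : realType}.
Variables (q : R) (m : int).
Hypotheses (q_gt0 : 0 < q) (q_neq1 : q != 1) (m_neq0 : m != 0).

Let q_neq0 : q != 0. Proof. exact: lt0r_neq0. Qed.

Let p : R := q ^ (- m).

Lemma onem_base_neq0 : 1 - p != 0.
Proof. by rewrite onem_exprz_neq0 // oppr_eq0. Qed.

(** The arguments [- a / m - i] of [qnum] need not be integers, but their products with [- m] are,
    which turns real powers of [p] into integer powers of [q]. *)
Lemma powR_base (x : R) (a : int) : - m%:~R * x = a%:~R -> p `^ x = q ^ a.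
Proof.
move=> xa; rewrite -!powR_intmul ?ltW // /p -powR_intmul ?ltW //.
by rewrite -powRrM mulrNz xa.
Qed.

Lemma qfalling_polya (a s : nat) :
  qfalling p (- a%:R / m%:~R) s =
  (1 - p)^-1 ^+ s * \prod_(i < s) (1 - q ^ (a%:Z + m * i%:Z)).
Proof.
rewrite -[s in _ ^+ s]card_ord -prodr_const -big_split; apply: eq_bigr => i _ /=.
rewrite /qnum mulrC; congr (_ * (1 - _)); apply: powR_base.
have m0 : m%:~R != 0 :> R by rewrite intr_eq0.
by rewrite intrD intrM -!pmulrn; field.
Qed.

(* [1 - p ^ j = - q ^ (- m j) * (1 - q ^ (m j))] is where [kappa] comes from. *)
Let kappa : R := - (1 - p)^-1.

Lemma qnum_nat (j : nat) :
  qnum p j%:R = kappa * q ^ (- (m * j%:Z)) * (1 - q ^ (m * j%:Z)).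
Proof.
rewrite /qnum (@powR_base _ (- (m * j%:Z))); last first.
  by rewrite mulrNz intrM mulNr -pmulrn.
rewrite /kappa -invr_expz.
have := expfz_neq0 (m * j%:Z) q_neq0; move: (q ^ (m * j)) => y y0.
have := onem_base_neq0; move: (1 - p) => z z0.
by field; rewrite y0.
Qed.

Lemma prod_qnum_nat s (g : nat -> nat) :
  \prod_(i < s) qnum p (g i)%:R =
  kappa ^+ s * q ^ (- (m * (\sum_(i < s) g i)%N%:Z)) *
  \prod_(i < s) (1 - q ^ (m * (g i)%:Z)).
Proof.
elim: s => [|s IHs].
  by rewrite !big_ord0 mulr0 oppr0 expr0z !mulr1.
rewrite !big_ord_recr IHs /= qnum_nat PoszD (mulrDr m) opprD expfzDr // exprSr.
ring.
Qed.

Lemma prod_qfactorial k (w : 'I_k -> nat) :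
  \prod_j qfactorial p (w j) =
  kappa ^+ (\sum_j w j)%N * q ^ (- (m * (\sum_j triangle (w j))%N%:Z))
  * \prod_j \prod_(i < w j) (1 - q ^ (m * i.+1%:Z)).
Proof.
elim: k w => [|k IHk] w; first by rewrite !big_ord0 mulr0 oppr0 expr0z !mulr1.
rewrite !big_ord_recr IHk /= /qfactorial (prod_qnum_nat _ succn).
rewrite PoszD (mulrDr m) opprD (expfzDr _ _ q_neq0) exprD -/(triangle _).
ring.
Qed.

(** Numerator and denominator both consist of [u] q-numbers, so the powers of [kappa] cancel and
    only a power of [q ^ m] is left over. *)
Lemma qmultinomialE k (w : 'I_k -> nat) n (u := (\sum_j w j)%N) : (0 < n)%N ->
  qmultinomial p (n%:R + u%:R - 1) w =
  q ^ (m * ((\sum_j triangle (w j))%N%:Z - (\sum_(i < u) (n + i))%N%:Z))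
  * (\prod_(i < u) (1 - q ^ (m * (n + i)%N%:Z))
     / \prod_j \prod_(i < w j) (1 - q ^ (m * i.+1%:Z))).
Proof.
move=> n0; rewrite /qmultinomial -/u.
have -> : qfalling p (n%:R + u%:R - 1) u = \prod_(i < u) qnum p (n + i)%N%:R.
  (* Reversal turns the falling product from [n + u - 1] into the rising product from [n]. *)
  rewrite /qfalling (reindex_inj rev_ord_inj); apply: eq_bigr => i _ /=.
  by congr qnum; rewrite natrB // natrD -[i.+1%:R]natr1; ring.
rewrite (prod_qnum_nat _ (addn n)) prod_qfactorial -/u.
have k0 : kappa ^+ u != 0 by rewrite expf_neq0 // oppr_eq0 invr_neq0 // onem_base_neq0.
rewrite mulrBr (expfzDr _ _ q_neq0) -(invr_expz _ (m * (\sum_j _)%N%:Z)).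
have := expfz_neq0 (m * (\sum_j triangle (w j))%N%:Z) q_neq0.
move: (q ^ (m * _)) (q ^ _) (kappa ^+ u) k0 (\prod_(i < u) _) (\prod_j _).
move=> y1 y2 y3 y30 x1 x2 y10.
rewrite !invfM invrK -[RHS]mulr1 -[in RHS](divff y30); ring.
Qed.

End BaseChange.

(** * Counts including the last color, and the final formula *)

Definition extend_count k (w : 'I_k -> nat) (n : nat) (c : 'I_k.+1) : nat :=
  oapp w n (insub (val c)).

Lemma extend_count_widen k (w : 'I_k -> nat) n (j : 'I_k) :
  extend_count w n (widen_ord (leqnSn k) j) = w j.
Proof. by rewrite /extend_count /= valK. Qed.

Lemma extend_count_max k (w : 'I_k -> nat) n : extend_count w n ord_max = n.
Proof. by rewrite /extend_count insubF //= ltnn. Qed.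

Lemma sum_extend_count k (w : 'I_k -> nat) n :
  (\sum_c extend_count w n c = n + \sum_j w j)%N.
Proof.
rewrite big_ord_recr /= extend_count_max addnC; congr (_ + _)%N.
by apply: eq_bigr => j _; rewrite extend_count_widen.
Qed.

(** This interprets [n + u_k - u_j] as the number of drawn balls of colors after [c_j]. *)
Lemma sum_gt_extend_count k (w : 'I_k -> nat) n (j : 'I_k) :
  (\sum_(c < k.+1 | j < c) extend_count w n c + partial_sum w j =
   n + \sum_i w i)%N.
Proof.
rewrite big_mkcond big_ord_recr /= ltn_ord extend_count_max.
rewrite addnAC addnC; congr (_ + _)%N.
rewrite [RHS](bigID (fun i : 'I_k => (j < i)%N)) /=; congr (_ + _)%N.
  by rewrite [RHS]big_mkcond; apply: eq_bigr => i _; rewrite extend_count_widen.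
by apply: eq_bigl => i; rewrite -leqNgt.
Qed.

(** The counts in [stop_event] precede the stopping draw, hence the decrement at the last color. *)
Lemma stop_eventE k (T : Type) (X : nat -> T -> option 'I_k.+1) n (w : 'I_k -> nat) :
  (0 < k)%N -> (0 < n)%N ->
  [set omega | forall j, inverse_count X n j omega = Some (w j)] =
  stop_event X (decr_count (extend_count w n) ord_max).
Proof.
move=> k0 n0; apply/seteqP; split=> omega.
  move=> /(inverse_countP _ _ _ k0 n0)[t [Xt nt ct]]; exists t; split=> // c.
  have [j ->|->] := unliftP ord_max c.
    have -> : lift ord_max j = widen_ord (leqnSn k) j.
      by apply: val_inj; rewrite /= /bump leqNgt ltn_ord.
    rewrite ct /decr_count extend_count_widen.
    case: eqP => [/(congr1 val)/= jk|_]; last by rewrite subn0.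
    by have := ltn_ord j; rewrite jk ltnn.
  by rewrite nt decr_count_id extend_count_max.
move=> [t [Xt nt]]; apply/(inverse_countP _ _ _ k0 n0); exists t; split=> // [|j].
  by rewrite nt decr_count_id extend_count_max.
rewrite nt /decr_count extend_count_widen; case: eqP => [/(congr1 val)/= jk|_].
  by have := ltn_ord j; rewrite jk ltnn.
by rewrite subn0.
Qed.

Theorem theorem4p1 (R : realType) (k : nat) (hk : (0 < k)%N)
    (q : R) (hq : 0 < q < 1 \/ 1 < q)
    (m : int) (hm : m != 0) (r : 'I_k.+1 -> nat)
    (d : measure_display) (T : measurableType d) (P : probability T R)
    (X : nat -> T -> option 'I_k.+1) (hX : qpolya_urn q m r P X)
    (n : nat) (hn : (0 < n)%N) (w : 'I_k -> nat) :
  let alpha : 'I_k -> R := polya_alpha m r in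
  let alpha_total : R := polya_alpha_total m r in
  let p : R := q ^ (- m) in
  let u_k : nat := (\sum_j w j)%N in
  let u : 'I_k -> nat := partial_sum w in
  let alpha_last : R := alpha_total - \sum_j alpha j in
  P [set omega | forall j : 'I_k, inverse_count X n j omega = Some (w j)] =
  (qmultinomial p (n%:R + u_k%:R - 1) w
   * q `^ (- m%:~R * \sum_j (n%:R + u_k%:R - (u j)%:R) * (alpha j - (w j)%:R))
   * ((\prod_j qfalling p (alpha j) (w j)) * qfalling p alpha_last n
      / qfalling p alpha_total (n + u_k)))%:E.
Proof.
move=> alpha alpha_total p u_k u alpha_last.
have [q0 q1] : 0 < q /\ q != 1.
  case: hq => [/andP[? q1]|q1]; first by rewrite lt_eqF.
  by rewrite gt_eqF // (lt_trans ltr01 q1).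
have m0 : m%:~R != 0 :> R by rewrite intr_eq0.
set v := extend_count w n.
have vmax : (0 < v ord_max)%N by rewrite /v extend_count_max.
have vN : (\sum_c v c = n + u_k)%N by exact: sum_extend_count.
set v' := decr_count v ord_max.
have v'N : (\sum_c v' c).+1 = (n + u_k)%N by rewrite -vN (sum_decr_count vmax).
rewrite stop_eventE // -/v -/v'.
have totE s : qfalling p alpha_total s =
    (1 - p)^-1 ^+ s * \prod_(i < s) (1 - q ^ urn_size m r i).
  exact: qfalling_polya.
have [[i [iv ui]]|nurn] := pselect (exists i, (i <= \sum_c v' c)%N /\ urn_size m r i = 0).
  rewrite (prob_stop_event_exhausted hX iv ui) totE.
  have iN : (i < n + u_k)%N by rewrite -v'N ltnS.
  (* An empty urn at step [i < n + u_k] puts a zero factor into the denominator, whose inverse is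
     0. *)
  by rewrite (bigD1 (Ordinal iN)) //= ui expr0z subrr mul0r mulr0 invr0 !mulr0.
have urn i : (i <= \sum_c v' c)%N -> urn_size m r i != 0.
  by move=> iv; apply/eqP => ui; apply: nurn; exists i.
rewrite (prob_stop_event hX q0 q1 urn); congr EFin.
have fS h c : (size h <= \sum_c v' c)%N ->
    hist_prob P X (rcons h c) = hist_prob P X h * draw_prob q m r h c.
  by move=> /urn; exact: hist_prob_rcons hX h c.
rewrite (sum_histories_rcons q0 q1 hm fS vmax); last 2 first.
- by rewrite vN.
- apply: sum_histories_count_law => //; first exact: hist_prob_nil.
  by move=> h c /ltnW; exact: fS.
pose tail (j : 'I_k) := (\sum_(c < k.+1 | j < c) v c)%N.
have tailE j : (n%:R + u_k%:R - (u j)%:R : R) = (tail j)%:R.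
  by rewrite -natrD -(sum_gt_extend_count w n j) natrD addrK.
have alpha_lastE : alpha_last = - (r ord_max)%:R / m%:~R.
  rewrite /alpha_last /alpha_total /alpha /polya_alpha /polya_alpha_total /total_balls.
  by rewrite -mulr_suml sumrN -natr_sum -mulrBl big_ord_recr /= natrD; congr (_ / _); ring.
(* Since [alpha j = - r j / m], multiplying [alpha j - w j] by [- m] gives the integer
   [r j + m * w j]. *)
have powE : q `^ (- m%:~R * \sum_j (n%:R + u_k%:R - (u j)%:R) * (alpha j - (w j)%:R)) =
    q ^ ((\sum_j r (widen_ord (leqnSn k) j) * tail j)%N%:Z + m * (\sum_j w j * tail j)%N%:Z).
  have -> : \sum_j (n%:R + u_k%:R - (u j)%:R) * (alpha j - (w j)%:R) =
      \sum_j (tail j)%:R * (alpha j - (w j)%:R).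
    by apply: eq_bigr => j _; rewrite tailE.
  rewrite -powR_intmul ?ltW // intrD intrM -!pmulrn !natr_sum !mulr_sumr -big_split.
  congr (q `^ _); apply: eq_bigr => j _ /=.
  by rewrite /alpha /polya_alpha !natrM; field.
have offsetE : (\sum_c v c * urn_offset r c =
    \sum_j r (widen_ord (leqnSn k) j) * tail j)%N.
  rewrite exchange_sum_ltn big_ord_recr /= [X in (_ * X)%N]big_pred0 => [|c].
    by rewrite muln0 addn0.
  by rewrite ltnNge -ltnS ltn_ord.
(* Two expansions of [triangle (n + u_k)] are compared, one along [n + u_k] and one along the
   colors; [triangle n] cancels. *)
have triE : (u_k + \sum_(i < u_k) (n + i) =
    \sum_j w j * tail j + \sum_j triangle (w j))%N.
  have := triangle_sum v; rewrite vN triangleD !big_ord_recr /=.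
  rewrite [X in (_ * X)%N]big_pred0 => [|c]; last by rewrite ltnNge -ltnS ltn_ord.
  rewrite /v extend_count_max -/v muln0 addn0 -addnA addnCA => /addnI.
  rewrite (eq_bigr (fun i : 'I_u_k => (1 + (n + i))%N)) // big_split /= sum1_card card_ord.
  move=> ->; rewrite addnC; congr (_ + _)%N;
    by apply: eq_bigr => j _; rewrite /v extend_count_widen.
(* The stopping draw contributes [q ^ (m * u_k)]; [triE] splits this into the base-change power and
   the [w] part of the stated exponent. *)
have expE : ((\sum_(b < k.+1 | (b < @ord_max k)%N) m * (v b)%:Z) =
    m * ((\sum_j triangle (w j))%N%:Z - (\sum_(i < u_k) (n + i))%N%:Z)
    + m * (\sum_j w j * tail j)%N%:Z)%R.
  rewrite -mulrDr -mulr_sumr; congr (_ * _); rewrite big_ord_lt_max.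
  transitivity u_k%:Z; last first.
    move/(congr1 Posz): triE; rewrite !PoszD => triZ.
    by rewrite addrAC (addrC (\sum_j triangle _)%N%:Z) -triZ addrK.
  by rewrite Posz_sum; apply: eq_bigr => j _; rewrite /v extend_count_widen.
(* With [b i = 1 - q ^ (m * i)], this turns the multinomial coefficient of [n + u_k] over [(w, n)],
   times [b n / b (n + u_k)] from the stopping draw, into the one of [n + u_k - 1] over [w]. *)
have prodE (b : nat -> R) : (\prod_(i < n + u_k) b i.+1) * b n =
    (\prod_(i < n) b i.+1) * (\prod_(i < u_k) b (n + i)%N) * b (n + u_k)%N.
  rewrite big_split_ord /= -!mulrA; congr (_ * _).
  rewrite -(big_ord_recr u_k (fun i : 'I_u_k.+1 => b (n + i)%N)) /=.
  rewrite big_ord_recl addn0 mulrC; congr (_ * _).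
  by apply: eq_bigr => i _; rewrite -addnS.
have splitE (f : 'I_k.+1 -> nat -> R) : \prod_c \prod_(i < v c) f c i =
    (\prod_j \prod_(i < w j) f (widen_ord (leqnSn k) j) i) *
    \prod_(i < n) f ord_max i.
  rewrite big_ord_recr /= /v extend_count_max; congr (_ * _).
  by apply: eq_bigr => j _; rewrite extend_count_widen.
have fallE : \prod_j qfalling p (alpha j) (w j) = (1 - p)^-1 ^+ u_k *
    \prod_j \prod_(i < w j) (1 - q ^ ((r (widen_ord (leqnSn k) j))%:Z + m * i%:Z)).
  rewrite -prodrXr -big_split; apply: eq_bigr => j _ /=.
  exact: qfalling_polya.
have l0 : (1 - p)^-1 != 0 by rewrite invr_neq0 // onem_base_neq0.
have q00 : q != 0 by rewrite lt0r_neq0.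
rewrite powE fallE totE alpha_lastE (qfalling_polya q0 hm) qmultinomialE //.
rewrite v'N /count_law vN offsetE expE -/u_k.
rewrite (splitE (fun _ i => 1 - q ^ (m * i.+1%:Z))).
rewrite (splitE (fun c i => 1 - q ^ ((r c)%:Z + m * i%:Z))).
rewrite {1}/v extend_count_max !(expfzDr _ _ q00) exprD.
have bpos s : (0 < s)%N -> 1 - q ^ (m * s%:Z) != 0.
  by case: s => // s _; rewrite onem_exprz_neq0 // mulf_neq0.
(* [L1] and [L2] are the powers of [(1 - p)^-1] from the falling factorials; those above and below
   cancel because [n + u_k] factors occur in each. *)
have collect (S W e B Bn Bf bn bN Bw A An AN L1 L2 : R) :
    Bn != 0 -> bN != 0 -> L1 != 0 -> L2 != 0 -> B * bn = Bn * Bf * bN ->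
    S * (B / (Bw * Bn)) * (A * An / AN) * (e * W * bn / bN) =
    e * (Bf / Bw) * (S * W) * (L1 * A * (L2 * An) / (L2 * L1 * AN)).
  move=> Bn0 bN0 L10 L20 BE; rewrite !invfM.
  transitivity ((B * bn) * Bn^-1 * bN^-1 * (e * W * S * A * An * Bw^-1 * AN^-1)).
    by ring.
  rewrite BE [RHS](_ : _ = (L1 / L1) * (L2 / L2) *
    (Bf * (e * W * S * A * An * Bw^-1 * AN^-1))); last by ring.
  rewrite !divff // !mul1r; congr (_ * _).
  by field; rewrite Bn0 bN0.
apply: collect (prodE (fun i => 1 - q ^ (m * i%:Z))).
- by rewrite prodf_seq_neq0; apply/allP => i _; rewrite /= bpos.
- by rewrite bpos // addn_gt0 hn.
- exact: expf_neq0.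
- exact: expf_neq0.
Qed.
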